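(* There exists $\kappa_0\in[0.55,0.56]$ such that for every $\kappa\in\,]\tfrac12,1[$ with $\kappa\le\kappa_0$, with $$V_{\xi,\eta}(x)=\big(S(\xi,x)-S(\eta,x),\;S'(\xi,x)-S'(\eta,x)\big),$$ one has $\inf_{x\in[0,1]}|V_{\xi,\eta}(x)|>0$ uniformly on $\{(\xi,\eta)\in[0,1]^2:\tfrac12<|\xi-\eta|\}$; that is, there is $\varepsilon>0$ (depending on $\kappa$) such that $|V_{\xi,\eta}(x)|\ge\varepsilon$ for all $x\in[0,1]$ and all $\xi,\eta\in[0,1]$ with $|\xi-\eta|>\tfrac12$.
   Context: Let $\gamma\in\,]\tfrac12,1[$ and $\kappa=\frac{1}{2\gamma}\in\,]\tfrac12,1[$. For $\xi\in[0,1]$ let $(\bar\xi_{-n})_{n\ge0}\in\{0,1\}^{\mathbb{N}}$ be its dyadic digits, $\xi=\sum_{n\ge0}\bar\xi_{-n}2^{-(n+1)}$; for a dyadic rational $\xi\neq0$ the expansion that is not eventually $0$ is chosen. For $k\ge0$ and $x\in[0,1]$, the second component of the $k$-th iterate of the baker's transformation is $$B_2^k(\xi,x)=\frac{\bar\xi_{-k+1}}{2}+\frac{\bar\xi_{-k+2}}{2^2}+\cdots+\frac{\bar\xi_0}{2^k}+\frac{x}{2^k}.$$ Define $S(\xi,x)=2\pi\sum_{n=1}^\infty\kappa^n\sin\big(2\pi B_2^n(\xi,x)\big)$. $S'$ denotes the derivative of $S$ with respect to $x$, and $|\cdot|$ the Euclidean norm on $\mathbb{R}^2$. *)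

(* Defs.v *)
From Stdlib Require Import Reals Lra Lia Arith ClassicalEpsilon FunctionalExtensionality.
From Coquelicot Require Import Coquelicot.
Open Scope R_scope.

(* Digit sequences are indexed by n >= 0: [d n] is the digit with index -n. *)
Definition bit (b : bool) : R := if b then 1 else 0.

Definition dyadic_rational (xi : R) : Prop :=
  exists (m : Z) (k : nat), xi = IZR m / 2 ^ k.

Definition eventually_zero (d : nat -> bool) : Prop :=
  exists N : nat, forall n : nat, (N <= n)%nat -> d n = false.

Definition is_dyadic_expansion (xi : R) (d : nat -> bool) : Prop :=
  is_series (fun n : nat => bit (d n) / 2 ^ (n + 1)) xi /\
  (dyadic_rational xi -> xi <> 0 -> ~ eventually_zero d).

(* For [0 <= xi <= 1] this is the unique sequence satisfying the predicate:
   see [digit_spec] and [digit_unique] below. *)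
Definition digit (xi : R) : nat -> bool :=
  epsilon (inhabits (fun _ : nat => false)) (is_dyadic_expansion xi).

(* The sum is digit_(k-1)/2 + digit_(k-2)/2^2 + ... + digit_0/2^k; it is empty
   for k = 0. *)
Definition B2 (k : nat) (xi x : R) : R :=
  sum_n_m (fun j : nat => bit (digit xi (k - j)) / 2 ^ j) 1 k + x / 2 ^ k.

(* The series starts at exponent 1.  The formula makes sense, and is smooth, for
   all real x, so that at x = 0 and x = 1 the two-sided derivative used below
   is the one-sided derivative of the restriction to [0, 1]. *)
Definition Sfun (kappa xi x : R) : R :=
  2 * PI *
  Series (fun n : nat => kappa ^ (n + 1) * sin (2 * PI * B2 (n + 1) xi x)).

(* The [norm] of [R * R] in Coquelicot is the Euclidean one, see [norm_V]. *)
Definition V (kappa xi eta x : R) : R * R :=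
  (Sfun kappa xi x - Sfun kappa eta x,
   Derive (Sfun kappa xi) x - Derive (Sfun kappa eta) x).

Lemma norm_V (kappa xi eta x : R) :
  norm (V kappa xi eta x) =
  sqrt ((Sfun kappa xi x - Sfun kappa eta x) ^ 2 +
        (Derive (Sfun kappa xi) x - Derive (Sfun kappa eta) x) ^ 2).
Proof.
  change (sqrt (Rabs (Sfun kappa xi x - Sfun kappa eta x) ^ 2 +
    Rabs (Derive (Sfun kappa xi) x - Derive (Sfun kappa eta) x) ^ 2) =
  sqrt ((Sfun kappa xi x - Sfun kappa eta x) ^ 2 +
        (Derive (Sfun kappa xi) x - Derive (Sfun kappa eta) x) ^ 2)).
  now rewrite !pow2_abs.
Qed.

Lemma bit_bound (b : bool) : 0 <= bit b <= 1.
Proof. destruct b; simpl; lra. Qed.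

Fixpoint remainder (xi : R) (n : nat) : R :=
  match n with
  | O => xi
  | S m => let r := remainder xi m in
           if Rlt_dec (1 / 2) r then 2 * r - 1 else 2 * r
  end.

Definition greedy (xi : R) (n : nat) : bool :=
  if Rlt_dec (1 / 2) (remainder xi n) then true else false.

Lemma remainder_S (xi : R) (n : nat) :
  remainder xi (S n) = 2 * remainder xi n - bit (greedy xi n).
Proof. unfold greedy; simpl; destruct (Rlt_dec _ _); simpl; lra. Qed.

Lemma remainder_bound (xi : R) (n : nat) :
  0 <= xi <= 1 -> 0 <= remainder xi n <= 1.
Proof.
  intros H; induction n as [|n IH]; [exact H|].
  simpl; destruct (Rlt_dec _ _); lra.
Qed.

Lemma remainder_pos (xi : R) (n : nat) : 0 < xi -> 0 < remainder xi n.
Proof.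
  intros H; induction n as [|n IH]; [exact H|].
  simpl; destruct (Rlt_dec _ _); lra.
Qed.

Lemma greedy_sum (xi : R) (n : nat) :
  sum_n (fun n : nat => bit (greedy xi n) / 2 ^ (n + 1)) n =
  xi - remainder xi (S n) / 2 ^ (n + 1).
Proof.
  induction n as [|n IH].
  - rewrite sum_O, remainder_S; simpl; field.
  - rewrite sum_Sn, IH, (remainder_S xi (S n)).
    unfold plus; simpl AbelianMonoid.plus; simpl.
    replace (n + 1)%nat with (S n) by lia; simpl.
    field; apply pow_nonzero; lra.
Qed.

Lemma pow2_large (r : R) : 0 < r -> exists k : nat, 1 < 2 ^ k * r.
Proof.
  intros Hr.
  destruct (Pow_x_infinity 2 (ltac:(rewrite Rabs_pos_eq; lra)) (1 / r + 1))
    as [k Hk].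
  exists k. specialize (Hk k (le_n k)).
  rewrite Rabs_pos_eq in Hk by (apply pow_le; lra).
  apply Rlt_le_trans with ((1 / r + 1) * r).
  - replace ((1 / r + 1) * r) with (1 + r) by (field; lra). lra.
  - apply Rmult_le_compat_r; lra.
Qed.

Lemma greedy_expansion (xi : R) :
  0 <= xi <= 1 -> is_dyadic_expansion xi (greedy xi).
Proof.
  intros Hxi; split.
  - change (is_lim_seq (sum_n (fun n => bit (greedy xi n) / 2 ^ (n + 1))) xi).
    apply (is_lim_seq_ext (fun n => xi - remainder xi (S n) / 2 ^ (n + 1))).
    { intros n; symmetry; apply greedy_sum. }
    replace (Finite xi) with (Finite (xi - 0)) by (f_equal; ring).
    apply is_lim_seq_minus'; [apply is_lim_seq_const|].
    apply is_lim_seq_le_le with (fun _ => 0) (fun n => (1 / 2) ^ (n + 1)).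
    + intros n. pose proof (remainder_bound xi (S n) Hxi).
      assert (0 < 2 ^ (n + 1)) by (apply pow_lt; lra).
      split; [apply Rdiv_le_0_compat; lra|].
      replace (1 / 2) with (/ 2) by lra; rewrite pow_inv.
      assert (0 < / 2 ^ (n + 1)) by now apply Rinv_0_lt_compat.
      unfold Rdiv; nra.
    + apply is_lim_seq_const.
    + apply (is_lim_seq_incr_n (fun n => (1 / 2) ^ n) 1).
      apply is_lim_seq_geom; rewrite Rabs_pos_eq; lra.
  - intros _ H0 [N HN].
    assert (Hp : 0 < remainder xi N) by (apply remainder_pos; lra).
    destruct (pow2_large _ Hp) as [k Hk].
    assert (E : forall j, remainder xi (N + j) = 2 ^ j * remainder xi N).
    { intros j; induction j as [|j IH].
      - rewrite Nat.add_0_r; simpl; ring.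
      - rewrite Nat.add_succ_r, remainder_S, IH, HN by lia; simpl; ring. }
    pose proof (remainder_bound xi (N + k) Hxi). rewrite E in H. lra.
Qed.

Lemma digit_spec (xi : R) :
  0 <= xi <= 1 -> is_dyadic_expansion xi (digit xi).
Proof.
  intros H; unfold digit; apply epsilon_spec.
  exists (greedy xi); now apply greedy_expansion.
Qed.

Lemma bits_ex_series (d : nat -> bool) :
  ex_series (fun n : nat => bit (d n) / 2 ^ (n + 1)).
Proof.
  apply (@ex_series_le R_AbsRing R_CompleteNormedModule _ (fun n => (1 / 2) ^ n)).
  - intros n. change (Rabs (bit (d n) / 2 ^ (n + 1)) <= (1 / 2) ^ n).
    pose proof (bit_bound (d n)).
    assert (0 < / 2 ^ n) by (apply Rinv_0_lt_compat, pow_lt; lra).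
    unfold Rdiv; rewrite Rmult_1_l, pow_inv, pow_add, Rinv_mult, pow_1.
    rewrite Rabs_pos_eq by nra. nra.
  - apply ex_series_geom; rewrite Rabs_pos_eq; lra.
Qed.

Lemma bits_series_S (d : nat -> bool) :
  2 * Series (fun n : nat => bit (d n) / 2 ^ (n + 1)) =
  bit (d O) + Series (fun n : nat => bit (d (S n)) / 2 ^ (n + 1)).
Proof.
  rewrite Series_incr_1 by apply bits_ex_series.
  rewrite Rmult_plus_distr_l, <- Series_scal_l. simpl pow at 1.
  f_equal; [field|]. apply Series_ext; intros n; simpl.
  field; apply pow_nonzero; lra.
Qed.

Lemma bits_series_ge0 (d : nat -> bool) :
  0 <= Series (fun n : nat => bit (d n) / 2 ^ (n + 1)).
Proof.
  rewrite <- (Rmult_0_l (Series (fun n => bit (d n) / 2 ^ (n + 1)))) at 1.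
  rewrite <- Series_scal_l. apply Series_le; [|apply bits_ex_series].
  intros n; rewrite Rmult_0_l; split; [lra|].
  apply Rdiv_le_0_compat; [apply bit_bound|apply pow_lt; lra].
Qed.

Lemma bits_series_le1 (d : nat -> bool) :
  Series (fun n : nat => bit (d n) / 2 ^ (n + 1)) <= 1.
Proof.
  replace 1 with (Series (fun n => / 2 * (1 / 2) ^ n)).
  - apply Series_le.
    + intros n. pose proof (bit_bound (d n)).
      assert (0 < / 2 ^ n) by (apply Rinv_0_lt_compat, pow_lt; lra).
      unfold Rdiv; rewrite Rmult_1_l, pow_inv, pow_add, Rinv_mult, pow_1. nra.
    + apply (ex_series_scal (/ 2) (fun n => (1 / 2) ^ n)).
      apply ex_series_geom; rewrite Rabs_pos_eq; lra.
  - rewrite Series_scal_l, Series_geom by (rewrite Rabs_pos_eq; lra). field.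
Qed.

Lemma bits_series_pos (d : nat -> bool) (n : nat) :
  d n = true -> 0 < Series (fun n : nat => bit (d n) / 2 ^ (n + 1)).
Proof.
  revert d; induction n as [|n IH]; intros d Hd;
    pose proof (bits_series_S d) as E.
  - pose proof (bits_series_ge0 (fun n => d (S n))). rewrite Hd in E.
    simpl bit in E; lra.
  - pose proof (IH (fun n => d (S n)) Hd). pose proof (bit_bound (d O)).
    simpl in H; lra.
Qed.

Lemma eventually_zero_dyadic (d : nat -> bool) (N : nat) :
  (forall n, (N <= n)%nat -> d n = false) ->
  dyadic_rational (Series (fun n : nat => bit (d n) / 2 ^ (n + 1))).
Proof.
  revert d; induction N as [|N IH]; intros d Hd.
  - exists 0%Z, O. rewrite (Series_ext _ (fun n => 0 * 0)).
    + rewrite Series_scal_l; simpl; field.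
    + intros n; rewrite Hd by lia; simpl; unfold Rdiv; ring.
  - destruct (IH (fun n => d (S n))) as (m & k & E).
    { intros n Hn; apply Hd; lia. }
    pose proof (bits_series_S d) as E'. rewrite E in E'.
    exists (m + (if d O then 2 ^ Z.of_nat k else 0))%Z, (S k).
    assert (2 ^ k <> 0) by (apply pow_nonzero; lra).
    replace (Series (fun n => bit (d n) / 2 ^ (n + 1)))
      with ((bit (d O) + IZR m / 2 ^ k) / 2) by lra.
    rewrite plus_IZR; destruct (d O); simpl bit.
    + rewrite <- pow_IZR; simpl; field; auto.
    + simpl; field; auto.
Qed.

Lemma not_eventually_zero (d : nat -> bool) (N : nat) :
  ~ eventually_zero d -> exists n, (N <= n)%nat /\ d n = true.
Proof.
  intros H. apply Classical_Prop.NNPP; intros H'. apply H; exists N; intros n Hn.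
  destruct (d n) eqn:E; [|reflexivity]. exfalso; apply H'; now exists n.
Qed.

Lemma bits_inj (d e : nat -> bool) (n : nat) :
  ~ eventually_zero d -> ~ eventually_zero e ->
  Series (fun n : nat => bit (d n) / 2 ^ (n + 1)) =
  Series (fun n : nat => bit (e n) / 2 ^ (n + 1)) ->
  d n = e n.
Proof.
  revert d e; induction n as [|n IH]; intros d e Hd He E.
  all: pose proof (bits_series_S d) as Ed; pose proof (bits_series_S e) as Ee.
  all: assert (E0 : d O = e O).
  1, 3: destruct (not_eventually_zero d 1 Hd) as ([|i] & Hi & Di); [lia|];
    destruct (not_eventually_zero e 1 He) as ([|j] & Hj & Ej); [lia|];
    pose proof (bits_series_pos (fun n => d (S n)) i Di);
    pose proof (bits_series_pos (fun n => e (S n)) j Ej);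
    pose proof (bits_series_le1 (fun n => d (S n)));
    pose proof (bits_series_le1 (fun n => e (S n)));
    destruct (d O), (e O); simpl bit in *; (reflexivity || (exfalso; lra)).
  - exact E0.
  - apply (IH (fun n => d (S n)) (fun n => e (S n))).
    + intros [N HN]; apply Hd; exists (S N); intros [|m] Hm; [lia|].
      apply HN; lia.
    + intros [N HN]; apply He; exists (S N); intros [|m] Hm; [lia|].
      apply HN; lia.
    + rewrite E0 in Ed; lra.
Qed.

Lemma expansion_unique (xi : R) (d e : nat -> bool) :
  is_dyadic_expansion xi d -> is_dyadic_expansion xi e -> d = e.
Proof.
  intros [Sd Hd] [Se He].
  apply is_series_unique in Sd; apply is_series_unique in Se.
  apply functional_extensionality; intros n.
  destruct (Req_dec xi 0) as [Z|NZ].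
  - destruct (d n) eqn:Dn.
    { pose proof (bits_series_pos d n Dn); exfalso; lra. }
    destruct (e n) eqn:En; [|reflexivity].
    pose proof (bits_series_pos e n En); exfalso; lra.
  - apply bits_inj.
    + intros [N HN]. apply Hd; [|exact NZ|now exists N].
      rewrite <- Sd; now apply eventually_zero_dyadic with N.
    + intros [N HN]. apply He; [|exact NZ|now exists N].
      rewrite <- Se; now apply eventually_zero_dyadic with N.
    + now rewrite Sd, Se.
Qed.

Lemma digit_unique (xi : R) (d : nat -> bool) :
  0 <= xi <= 1 -> is_dyadic_expansion xi d -> digit xi = d.
Proof.
  intros H Hd; apply expansion_unique with xi; [now apply digit_spec|exact Hd].
Qed.

(* Main.v *)
Require Import Defs.
From Stdlib Require Import Reals Lra Lia.
From Coquelicot Require Import Coquelicot.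
Open Scope R_scope.

(** Up to positive factors, the two components of [V] are
    [F = sum k^n (sin - sin)] and [G = sum (k/2)^n (cos - cos)], and by symmetry
    one may assume [xi - eta > 1/2].  The leading digits are then 1 and 0, so
    the first terms are [-2 k sin (pi x)] and [- k cos (pi x)].  If
    [|cos (pi x)| >= 2/5], the first term of [G] dominates the geometric bound
    of the rest.  Otherwise [sin (pi x) >= 9/10], and the first term of [F]
    dominates: [xi - eta > 1/2] excludes the second digits 0 for [xi] and 1 for
    [eta], the only case in which the second term of [F] is large and of the
    opposite sign. *)

(** * Series dominated by a geometric series *)

Lemma ex_series_geom_le (a : nat -> R) (M q : R) :
  0 <= q < 1 -> (forall n, Rabs (a n) <= M * q ^ n) -> ex_series a.
Proof.
  intros Hq H.
  apply (@ex_series_le R_AbsRing R_CompleteNormedModule a (fun n => M * q ^ n) H).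
  apply (ex_series_scal M (fun n => q ^ n)), ex_series_geom.
  rewrite Rabs_pos_eq; lra.
Qed.

Lemma Series_geom_le (a : nat -> R) (M q : R) :
  0 <= q < 1 -> (forall n, Rabs (a n) <= M * q ^ n) ->
  Rabs (Series a) <= M / (1 - q).
Proof.
  intros Hq H.
  assert (Hq' : Rabs q < 1) by (rewrite Rabs_pos_eq; lra).
  assert (Hg : ex_series (fun n => M * q ^ n))
    by (apply (ex_series_scal M (fun n => q ^ n)); now apply ex_series_geom).
  apply Rle_trans with (Series (fun n => Rabs (a n))).
  - apply Series_Rabs, (ex_series_geom_le _ M q Hq).
    intros n; rewrite Rabs_Rabsolu; apply H.
  - replace (M / (1 - q)) with (Series (fun n => M * q ^ n))
      by (rewrite Series_scal_l, Series_geom by assumption; reflexivity).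
    apply Series_le; [|exact Hg].
    intros n; split; [apply Rabs_pos|apply H].
Qed.

(** * Term-by-term differentiation of S *)

(** The mean value theorem is applied twice: the error is [h * (cos c - cos a)] with [c] between [a]
    and [a + h], so that [Rabs (c - a) <= Rabs h]. The crude constant 1 suffices for
    differentiability. *)
Lemma sin_taylor1 (a h : R) : Rabs (sin (a + h) - sin a - h * cos a) <= h ^ 2.
Proof.
  destruct (MVT_gen sin a (a + h) cos) as (c & Hc & E).
  - intros y _; apply is_derive_Reals, derivable_pt_lim_sin.
  - intros y _; apply continuity_sin.
  - destruct (MVT_gen cos a c (fun y => - sin y)) as (e & _ & E').
    + intros y _; apply is_derive_Reals, derivable_pt_lim_cos.
    + intros y _; apply continuity_cos.
    + rewrite E. replace (cos c * (a + h - a) - h * cos a)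
        with (h * (cos c - cos a)) by ring.
      rewrite E', !Rabs_mult, Rabs_Ropp, <- (pow2_abs h).
      assert (Rabs (c - a) <= Rabs h).
      { unfold Rmin, Rmax in Hc.
        destruct (Rle_dec a (a + h)); unfold Rabs;
          destruct (Rcase_abs (c - a)), (Rcase_abs h); lra. }
      assert (Rabs (sin e) <= 1) by (apply Rabs_le, SIN_bound).
      pose proof (Rabs_pos (sin e)); pose proof (Rabs_pos (c - a)).
      pose proof (Rabs_pos h). simpl. rewrite Rmult_1_r.
      apply Rmult_le_compat_l; nra.
Qed.

Lemma is_derive_quadratic (f : R -> R) (x l C : R) :
  (forall y, Rabs (f y - f x - (y - x) * l) <= C * (y - x) ^ 2) ->
  is_derive f x l.
Proof.
  intros H; apply is_derive_Reals; intros eps Heps.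
  (* The added 1 keeps the radius below well defined even when [C] is 0. *)
  assert (HC : 0 < Rabs C + 1) by (pose proof (Rabs_pos C); lra).
  assert (Hd : 0 < eps / (Rabs C + 1)) by now apply Rdiv_lt_0_compat.
  exists (mkposreal _ Hd); simpl; intros h Hh Hlt.
  specialize (H (x + h)). replace (x + h - x) with h in H by ring.
  replace ((f (x + h) - f x) / h - l) with ((f (x + h) - f x - h * l) / h)
    by now field.
  unfold Rdiv at 1; rewrite Rabs_mult, Rabs_inv.
  assert (Hh' : 0 < Rabs h) by now apply Rabs_pos_lt.
  apply Rmult_lt_reg_r with (Rabs h); [exact Hh'|].
  rewrite Rmult_assoc, Rinv_l, Rmult_1_r by lra.
  apply Rle_lt_trans with (1 := H). rewrite <- (pow2_abs h).
  assert (Rabs h * (Rabs C + 1) < eps).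
  { apply Rmult_lt_reg_r with (/ (Rabs C + 1)); [now apply Rinv_0_lt_compat|].
    rewrite Rmult_assoc, Rinv_r, Rmult_1_r by lra. exact Hlt. }
  pose proof (Rle_abs C). nra.
Qed.

(** The quadratic remainders add up to a quadratic remainder with constant [Series c]; summability
    of [c] takes the place of uniform convergence of the derivatives. *)
Lemma is_derive_Series (f : nat -> R -> R) (l c : nat -> R) (x : R) :
  (forall y, ex_series (fun n => f n y)) -> ex_series l -> ex_series c ->
  (forall n y, Rabs (f n y - f n x - (y - x) * l n) <= c n * (y - x) ^ 2) ->
  is_derive (fun y => Series (fun n => f n y)) x (Series l).
Proof.
  intros Hf Hl Hc H.
  apply is_derive_quadratic with (Series c); intros y.
  assert (Hyl : ex_series (fun n => (y - x) * l n))
    by now apply (ex_series_scal (y - x) l).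
  assert (Hyx : ex_series (fun n => f n y - f n x))
    by now apply (ex_series_minus (fun n => f n y) (fun n => f n x)).
  assert (Hcy : ex_series (fun n => c n * (y - x) ^ 2))
    by now apply (ex_series_scal_r ((y - x) ^ 2) c).
  rewrite <- Series_scal_l, <- Series_minus, <- Series_minus by auto.
  rewrite <- Series_scal_r.
  apply Rle_trans with
    (Series (fun n => Rabs (f n y - f n x - (y - x) * l n))).
  - apply Series_Rabs.
    apply (@ex_series_le R_AbsRing R_CompleteNormedModule _
             (fun n => c n * (y - x) ^ 2)); [|exact Hcy].
    intros n; change (Rabs (Rabs (f n y - f n x - (y - x) * l n)) <=
                      c n * (y - x) ^ 2).
    rewrite Rabs_Rabsolu; apply H.
  - apply Series_le; [|exact Hcy].
    intros n; split; [apply Rabs_pos|apply H].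
Qed.

Lemma B2_affine (k : nat) (xi x y : R) :
  B2 k xi y = B2 k xi x + (y - x) / 2 ^ k.
Proof. unfold B2; field; apply pow_nonzero; lra. Qed.

Lemma ex_series_geom_mult (b : nat -> R) (q : R) :
  0 <= q < 1 -> (forall n, Rabs (b n) <= 1) ->
  ex_series (fun n => q ^ (n + 1) * b n).
Proof.
  intros Hq Hb; apply (ex_series_geom_le _ 1 q Hq); intros n.
  assert (0 <= q ^ n) by (apply pow_le; lra).
  rewrite Rabs_mult, pow_add, pow_1, (Rabs_pos_eq (_ * _)) by nra.
  rewrite Rmult_1_l, Rmult_assoc.
  pose proof (Hb n); pose proof (Rabs_pos (b n)).
  rewrite <- (Rmult_1_r (_ ^ n)) at 2; apply Rmult_le_compat_l; nra.
Qed.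

Lemma ex_series_Sfun (kappa xi x : R) :
  0 <= kappa < 1 ->
  ex_series (fun n => kappa ^ (n + 1) * sin (2 * PI * B2 (n + 1) xi x)).
Proof.
  intros Hk; apply ex_series_geom_mult; [lra|].
  intros n; apply Rabs_le, SIN_bound.
Qed.

Lemma ex_series_Sfun' (kappa xi x : R) :
  0 <= kappa < 1 ->
  ex_series (fun n => (kappa / 2) ^ (n + 1) * cos (2 * PI * B2 (n + 1) xi x)).
Proof.
  intros Hk; apply ex_series_geom_mult; [lra|].
  intros n; apply Rabs_le, COS_bound.
Qed.

(** [B2 (n + 1)] has slope [1 / 2 ^ (n + 1)] in [x], which turns the ratio [kappa] into
    [kappa / 2]. *)
Lemma Derive_Sfun (kappa xi x : R) :
  0 <= kappa < 1 ->
  Derive (Sfun kappa xi) x =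
  (2 * PI) ^ 2 *
  Series (fun n => (kappa / 2) ^ (n + 1) * cos (2 * PI * B2 (n + 1) xi x)).
Proof.
  intros Hk.
  replace ((2 * PI) ^ 2) with (2 * PI * (2 * PI)) by ring.
  rewrite Rmult_assoc, <- Series_scal_l.
  apply is_derive_unique. unfold Sfun.
  apply (is_derive_scal
    (fun y => Series (fun n => kappa ^ (n + 1) * sin (2 * PI * B2 (n + 1) xi y)))).
  apply (is_derive_Series
    (fun n y => kappa ^ (n + 1) * sin (2 * PI * B2 (n + 1) xi y)) _
    (fun n => (2 * PI) ^ 2 * kappa ^ n)).
  - intros y; now apply ex_series_Sfun.
  - apply (ex_series_scal (2 * PI) (fun n =>
      (kappa / 2) ^ (n + 1) * cos (2 * PI * B2 (n + 1) xi x))).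
    now apply ex_series_Sfun'.
  - apply (ex_series_scal ((2 * PI) ^ 2) (fun n => kappa ^ n)), ex_series_geom.
    rewrite Rabs_pos_eq; lra.
  - intros n y.
    rewrite (B2_affine (n + 1) xi x y).
    set (b := 2 * PI * B2 (n + 1) xi x).
    set (h := 2 * PI * (y - x) / 2 ^ (n + 1)).
    assert (Hp : 1 <= 2 ^ (n + 1)) by (apply pow_R1_Rle; lra).
    replace (2 * PI * (B2 (n + 1) xi x + (y - x) / 2 ^ (n + 1))) with (b + h)
      by (unfold b, h; field; lra).
    replace (kappa ^ (n + 1) * sin (b + h) - kappa ^ (n + 1) * sin b -
        (y - x) * (2 * PI * ((kappa / 2) ^ (n + 1) * cos b)))
      with (kappa ^ (n + 1) * (sin (b + h) - sin b - h * cos b)).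
    2: { unfold h; replace ((kappa / 2) ^ (n + 1))
           with (kappa ^ (n + 1) / 2 ^ (n + 1))
           by (unfold Rdiv; rewrite Rpow_mult_distr, pow_inv; reflexivity).
         field; lra. }
    assert (Hkn : 0 <= kappa ^ n) by (apply pow_le; lra).
    assert (Hk1 : 0 <= kappa ^ (n + 1) <= kappa ^ n)
      by (rewrite pow_add, pow_1; nra).
    rewrite Rabs_mult, Rabs_pos_eq by lra.
    (* One factor [kappa] is dropped here and [(/ 2 ^ (n + 1)) ^ 2] below, which leaves a summable
       geometric constant. *)
    apply Rle_trans with (kappa ^ n * h ^ 2).
    + apply Rmult_le_compat; try lra; [apply Rabs_pos|apply sin_taylor1].
    + replace ((2 * PI) ^ 2 * kappa ^ n * (y - x) ^ 2)
        with (kappa ^ n * (2 * PI * (y - x)) ^ 2) by ring.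
      apply Rmult_le_compat_l; [lra|].
      unfold h, Rdiv; rewrite Rpow_mult_distr.
      assert (0 < / 2 ^ (n + 1) <= 1).
      { split; [apply Rinv_0_lt_compat; lra|].
        rewrite <- Rinv_1; apply Rinv_le_contravar; lra. }
      assert ((/ 2 ^ (n + 1)) ^ 2 <= 1) by nra.
      pose proof (pow2_ge_0 (2 * PI * (y - x))). nra.
Qed.

(** * Leading digits and first iterates *)

(** Splitting off two digits leaves a digit series with value in [0, 1], scaled by 1/4. *)
Lemma digits01 (xi : R) :
  0 <= xi <= 1 ->
  bit (digit xi 0) / 2 + bit (digit xi 1) / 4 <= xi <=
  bit (digit xi 0) / 2 + bit (digit xi 1) / 4 + 1 / 4.
Proof.
  intros H; destruct (digit_spec xi H) as [E _].
  apply is_series_unique in E.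
  pose proof (bits_series_S (digit xi)) as E0.
  pose proof (bits_series_S (fun n => digit xi (S n))) as E1.
  pose proof (bits_series_ge0 (fun n => digit xi (S (S n)))).
  pose proof (bits_series_le1 (fun n => digit xi (S (S n)))).
  simpl in *; lra.
Qed.

Lemma B2_1 (xi x : R) : B2 1 xi x = bit (digit xi 0) / 2 + x / 2.
Proof. unfold B2; rewrite sum_n_n; simpl; field. Qed.

Lemma B2_2 (xi x : R) :
  B2 2 xi x = bit (digit xi 1) / 2 + bit (digit xi 0) / 4 + x / 4.
Proof.
  unfold B2; rewrite sum_n_Sm, sum_n_n by lia.
  unfold plus; simpl; field.
Qed.

(** * Leading terms and tails of the components of [V] *)

Lemma norm_V_ge (kappa xi eta x : R) :
  Rabs (Sfun kappa xi x - Sfun kappa eta x) <= norm (V kappa xi eta x) /\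
  Rabs (Derive (Sfun kappa xi) x - Derive (Sfun kappa eta) x)
    <= norm (V kappa xi eta x).
Proof.
  rewrite norm_V; split; rewrite <- sqrt_Rsqr_abs; apply sqrt_le_1_alt;
    unfold Rsqr;
    pose proof (pow2_ge_0 (Sfun kappa xi x - Sfun kappa eta x));
    pose proof (pow2_ge_0 (Derive (Sfun kappa xi) x - Derive (Sfun kappa eta) x));
    nra.
Qed.

Lemma norm_V_sym (kappa xi eta x : R) :
  norm (V kappa xi eta x) = norm (V kappa eta xi x).
Proof. rewrite !norm_V; f_equal; ring. Qed.

(** Two terms are kept exactly, because a geometric bound on everything after the first would exceed
    the first. The tail starts at exponent 3, and each difference of sines is at most 2 in absolute
    value. *)
Lemma Sfun_minus_expand (kappa xi eta x : R) :
  0 < kappa < 1 ->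
  exists t, Rabs t <= 2 * kappa ^ 3 / (1 - kappa) /\
    Sfun kappa xi x - Sfun kappa eta x = 2 * PI * (
      kappa * (sin (2 * PI * B2 1 xi x) - sin (2 * PI * B2 1 eta x)) +
      kappa ^ 2 * (sin (2 * PI * B2 2 xi x) - sin (2 * PI * B2 2 eta x)) + t).
Proof.
  intros Hk.
  set (a := fun n => kappa ^ (n + 1) *
    (sin (2 * PI * B2 (n + 1) xi x) - sin (2 * PI * B2 (n + 1) eta x))).
  exists (Series (fun n => a (S (S n)))); split.
  - apply Series_geom_le; [lra|]; intros n; unfold a.
    replace (S (S n) + 1)%nat with (n + 3)%nat by lia.
    rewrite Rabs_mult, pow_add.
    assert (0 < kappa ^ n) by (apply pow_lt; lra).
    assert (0 < kappa ^ 3) by (apply pow_lt; lra).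
    rewrite (Rabs_pos_eq (_ * _)) by nra.
    replace (2 * kappa ^ 3 * kappa ^ n) with (kappa ^ n * kappa ^ 3 * 2) by ring.
    apply Rmult_le_compat_l; [nra|].
    pose proof (SIN_bound (2 * PI * B2 (n + 3) xi x)).
    pose proof (SIN_bound (2 * PI * B2 (n + 3) eta x)).
    apply Rabs_le; lra.
  - unfold Sfun; rewrite <- Rmult_minus_distr_l; f_equal.
    rewrite <- Series_minus by (apply ex_series_Sfun; lra).
    assert (Ha : ex_series a).
    { apply (ex_series_ext (fun n =>
        minus (kappa ^ (n + 1) * sin (2 * PI * B2 (n + 1) xi x))
              (kappa ^ (n + 1) * sin (2 * PI * B2 (n + 1) eta x)))).
      - intros n; unfold a, minus, plus, opp; simpl; ring.
      - apply (ex_series_minus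
          (fun n => kappa ^ (n + 1) * sin (2 * PI * B2 (n + 1) xi x)));
          apply ex_series_Sfun; lra. }
    rewrite (Series_ext _ a) by (intros n; unfold a; ring).
    rewrite Series_incr_1 by exact Ha.
    rewrite Series_incr_1 by now apply ex_series_incr_1 in Ha.
    unfold a at 1 2; simpl Nat.add; ring.
Qed.

(** Here the ratio is [kappa / 2], small enough for one exact term to do. *)
Lemma Derive_Sfun_minus_expand (kappa xi eta x : R) :
  0 < kappa < 1 ->
  exists t, Rabs t <= 2 * (kappa / 2) ^ 2 / (1 - kappa / 2) /\
    Derive (Sfun kappa xi) x - Derive (Sfun kappa eta) x = (2 * PI) ^ 2 * (
      kappa / 2 * (cos (2 * PI * B2 1 xi x) - cos (2 * PI * B2 1 eta x)) + t).
Proof.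
  intros Hk.
  set (a := fun n => (kappa / 2) ^ (n + 1) *
    (cos (2 * PI * B2 (n + 1) xi x) - cos (2 * PI * B2 (n + 1) eta x))).
  exists (Series (fun n => a (S n))); split.
  - apply Series_geom_le; [lra|]; intros n; unfold a.
    replace (S n + 1)%nat with (n + 2)%nat by lia.
    rewrite Rabs_mult, pow_add.
    assert (0 < (kappa / 2) ^ n) by (apply pow_lt; lra).
    assert (0 < (kappa / 2) ^ 2) by (apply pow_lt; lra).
    rewrite (Rabs_pos_eq (_ * _)) by nra.
    replace (2 * (kappa / 2) ^ 2 * (kappa / 2) ^ n)
      with ((kappa / 2) ^ n * (kappa / 2) ^ 2 * 2) by ring.
    apply Rmult_le_compat_l; [nra|].
    pose proof (COS_bound (2 * PI * B2 (n + 2) xi x)).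
    pose proof (COS_bound (2 * PI * B2 (n + 2) eta x)).
    apply Rabs_le; lra.
  - rewrite !Derive_Sfun by lra; rewrite <- Rmult_minus_distr_l; f_equal.
    rewrite <- Series_minus by (apply ex_series_Sfun'; lra).
    assert (Ha : ex_series a).
    { apply (ex_series_ext (fun n =>
        minus ((kappa / 2) ^ (n + 1) * cos (2 * PI * B2 (n + 1) xi x))
              ((kappa / 2) ^ (n + 1) * cos (2 * PI * B2 (n + 1) eta x)))).
      - intros n; unfold a, minus, plus, opp; simpl; ring.
      - apply (ex_series_minus
          (fun n => (kappa / 2) ^ (n + 1) * cos (2 * PI * B2 (n + 1) xi x)));
          apply ex_series_Sfun'; lra. }
    rewrite (Series_ext _ a) by (intros n; unfold a; ring).
    rewrite Series_incr_1 by exact Ha.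
    unfold a at 1; simpl Nat.add; ring.
Qed.

(** * Lower bound by cases on the size of the cosine *)

(** Serves to discard the prefactors [2 * PI] and [(2 * PI) ^ 2]. *)
Lemma Rabs_mult_ge1 (c r e : R) : 1 <= c -> e <= Rabs r -> e <= Rabs (c * r).
Proof.
  intros Hc Hr; rewrite Rabs_mult, (Rabs_pos_eq c) by lra.
  pose proof (Rabs_pos r); nra.
Qed.

Lemma norm_V_ge_ordered (kappa xi eta x : R) :
  1 / 2 < kappa <= 55 / 100 ->
  0 <= xi <= 1 -> 0 <= eta <= 1 -> 1 / 2 < xi - eta -> 0 <= x <= 1 ->
  1 / 100 <= norm (V kappa xi eta x).
Proof.
  intros Hk Hxi Heta Hd Hx.
  pose proof PI_4. pose proof PI2_1 as HPI.
  destruct (norm_V_ge kappa xi eta x) as [HF HG].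
  destruct (Sfun_minus_expand kappa xi eta x) as (t & Ht & EF); [lra|].
  destruct (Derive_Sfun_minus_expand kappa xi eta x) as (u & Hu & EG); [lra|].
  pose proof (digits01 xi Hxi) as Dxi. pose proof (digits01 eta Heta) as Deta.
  rewrite !B2_1 in EF, EG; rewrite !B2_2 in EF.
  (* Since both numbers lie in [0, 1], the gap forces [xi > 1 / 2] and [eta < 1 / 2]. *)
  assert (X0 : digit xi 0 = true).
  { destruct (digit xi 0), (digit xi 1), (digit eta 0), (digit eta 1);
      simpl bit in *; (reflexivity || (exfalso; lra)). }
  assert (Y0 : digit eta 0 = false).
  { destruct (digit xi 0), (digit xi 1), (digit eta 0), (digit eta 1);
      simpl bit in *; (reflexivity || (exfalso; lra)). }
  rewrite X0, Y0 in *; simpl bit in *.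
  (* The leading digit 1 shifts the angle by [PI] and so flips both sine and cosine. *)
  replace (2 * PI * (1 / 2 + x / 2)) with (PI * x + PI) in EF, EG by field.
  replace (2 * PI * (0 / 2 + x / 2)) with (PI * x) in EF, EG by field.
  rewrite neg_sin in EF; rewrite neg_cos in EG.
  set (s := sin (PI * x)) in *. set (c := cos (PI * x)) in *.
  assert (Hsc : s ^ 2 + c ^ 2 = 1).
  { pose proof (sin2_cos2 (PI * x)) as E; unfold Rsqr in E.
    fold s c in E; lra. }
  destruct (Rle_lt_dec (2 / 5) (Rabs c)) as [Hc|Hc].
  - apply Rle_trans with (2 := HG). rewrite EG. apply Rabs_mult_ge1; [nra|].
    replace (kappa / 2 * (- c - c) + u) with (- (kappa * c - u)) by field.
    rewrite Rabs_Ropp.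
    apply Rle_trans with (Rabs (kappa * c) - Rabs u); [|apply Rabs_triang_inv].
    rewrite Rabs_mult, (Rabs_pos_eq kappa) by lra.
    (* The tail divided by [kappa] is [kappa / (2 - kappa)], which equals 11/29 at 55/100. What
       remains is at least [kappa * (2 / 5 - 11 / 29)], above 3/290 and hence above 1/100. *)
    assert (2 * (kappa / 2) ^ 2 / (1 - kappa / 2) <= kappa * (11 / 29)).
    { apply Rmult_le_reg_r with (1 - kappa / 2); [lra|].
      unfold Rdiv at 1; rewrite Rmult_assoc, Rinv_l by lra. nra. }
    nra.
  - apply Rle_trans with (2 := HF). rewrite EF. apply Rabs_mult_ge1; [nra|].
    assert (Hs0 : 0 <= s) by (apply sin_ge_0; nra).
    assert (Hc2 : c ^ 2 < 16 / 100).
    { rewrite <- pow2_abs. pose proof (Rabs_pos c). nra. }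
    assert (Hs : 9 / 10 <= s) by nra.
    (* At 55/100 the quotient [2 * kappa ^ 2 / (1 - kappa)] is 121/90, just below 1.35. *)
    assert (Ht' : Rabs t <= kappa * (135 / 100)).
    { apply Rle_trans with (1 := Ht).
      apply Rmult_le_reg_r with (1 - kappa); [lra|].
      unfold Rdiv at 1; rewrite Rmult_assoc, Rinv_l by lra. nra. }
    assert (Hh : 0 <= sin (PI * x / 2) /\ 0 <= cos (PI * x / 2)).
    { split; [apply sin_ge_0|apply cos_ge_0]; nra. }
    set (v := sin (PI * x / 2)) in *. set (w := cos (PI * x / 2)) in *.
    assert (Hvw : v ^ 2 + w ^ 2 = 1).
    { pose proof (sin2_cos2 (PI * x / 2)) as E; unfold Rsqr in E.
      fold v w in E; lra. }
    assert (Hsvw : s = 2 * v * w).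
    { unfold s; replace (PI * x) with (2 * (PI * x / 2)) by field.
      apply sin_2a. }
    (* Indeed [(w - v) ^ 2 = 1 - s <= 1 / 10], and 0.32 squared is 0.1024. *)
    assert (Hdiff : - (32 / 100) <= w - v <= 32 / 100) by nra.
    match goal with |- context [kappa ^ 2 * ?e] =>
      assert (He : e <= 32 / 100); [|set (d := e) in *] end.
    { replace (2 * PI * (bit (digit xi 1) / 2 + 1 / 4 + x / 4))
        with (PI / 2 + PI * x / 2 + bit (digit xi 1) * PI) by field.
      replace (2 * PI * (bit (digit eta 1) / 2 + 0 / 4 + x / 4))
        with (PI * x / 2 + bit (digit eta 1) * PI) by field.
      (* The two sines are [w] and [v], each negated when its second digit is 1. Equal digits give
         [w - v] or [v - w]; digits 1 and 0 give [- w - v <= 0]; digits 0 and 1 would give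
         [xi <= 3 / 4] and [eta >= 1 / 4], against the gap. *)
      destruct (digit xi 1), (digit eta 1); simpl bit in *;
        rewrite ?Rmult_1_l, ?Rmult_0_l, ?Rplus_0_r, ?neg_sin, <- ?cos_sin;
        fold v w; lra. }
    pose proof (Rle_abs t).
    (* The first term is [- 2 * kappa * s], so the sum is negated; it is then at least
       [kappa * (1.8 - 0.176 - 1.35)]. *)
    rewrite <- Rabs_Ropp.
    apply Rle_trans with (2 := Rle_abs _).
    assert (kappa ^ 2 * d <= kappa * (55 / 100 * (32 / 100))) by nra.
    nra.
Qed.

Theorem proposition4p4 :
  exists kappa0 : R,
    55 / 100 <= kappa0 <= 56 / 100 /\
    forall kappa : R,
      1 / 2 < kappa < 1 ->
      kappa <= kappa0 ->
      exists eps : R,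
        0 < eps /\
        forall xi eta x : R,
          0 <= xi <= 1 ->
          0 <= eta <= 1 ->
          1 / 2 < Rabs (xi - eta) ->
          0 <= x <= 1 ->
          eps <= norm (V kappa xi eta x).
Proof.
  exists (55 / 100); split; [lra|]; intros kappa Hk Hk0.
  (* One bound serves every [kappa] in the range. *)
  exists (1 / 100); split; [lra|]; intros xi eta x Hxi Heta Hd Hx.
  unfold Rabs in Hd; destruct (Rcase_abs (xi - eta)).
  - rewrite norm_V_sym; apply norm_V_ge_ordered; lra.
  - apply norm_V_ge_ordered; lra.
Qed.
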